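(* The set of terms of the sequence $\mathcal{Z}_{(2,1)}(1,3)$ is $$\{3,15\}\cup\big((4\mathbb{Z}_{\geqslant 0}+1)\setminus\{9\}\big)=\{1,3,5,13,15,17,21,25,\dots\}.$$
   Context: For positive integers $a<b$, the $(2,1)$-sequence $\mathcal{Z}_{(2,1)}(a,b)=(a_m)_{m\geqslant1}$ is defined greedily by $a_1=a$, $a_2=b$, and, for $m\geqslant 2$, $a_{m+1}$ is the smallest integer larger than $a_m$ for which there is exactly one ordered pair $(x,y)$ of distinct earlier terms $x,y\in\{a_1,\dots,a_m\}$, $x\neq y$, with $2x+y=a_{m+1}$. *)

(* Defs.v *)
From mathcomp Require Import all_boot zify.
From mathcomp Require Import boolp classical_sets.

Set Implicit Arguments.
Unset Strict Implicit.
Unset Printing Implicit Defensive.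

Definition uniquely_represented (T : seq nat) (n : nat) : Prop :=
  exists! p : nat * nat,
    [/\ p.1 \in T, p.2 \in T, p.1 != p.2 & 2 * p.1 + p.2 = n].

(* Indices are shifted by one: [u m] is the term a_{m+1}, so that
   [mkseq u m.+1] lists the terms preceding [u m.+1]. *)
Definition is_Z21 (a b : nat) (u : nat -> nat) : Prop :=
  [/\ u 0 = a, u 1 = b &
      forall m, 1 <= m ->
        [/\ u m < u m.+1,
            uniquely_represented (mkseq u m.+1) (u m.+1) &
            forall n, u m < n -> uniquely_represented (mkseq u m.+1) n ->
              u m.+1 <= n]].

(* For 0 < a < b there is exactly one such sequence: see [Z21P] and
   [is_Z21_inj]; otherwise the value may be junk. *)
Definition Z21 (a b : nat) : nat -> nat :=
  xget (fun=> 0) [set u | is_Z21 a b u]%classic.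

Lemma is_Z21_inj a b u v : is_Z21 a b u -> is_Z21 a b v -> u = v.
Proof.
move=> [u0 u1 uS] [v0 v1 vS]; apply/funext => n.
elim/ltn_ind: n => -[|[|n]] IH; [by rewrite u0 v0|by rewrite u1 v1|].
have e : mkseq u n.+2 = mkseq v n.+2.
  by apply/eq_in_map => i; rewrite mem_iota add0n => /andP[_ /IH].
have [ul ur um] := uS n.+1 isT; have [vl vr vm] := vS n.+1 isT.
have en : u n.+1 = v n.+1 by apply: IH.
apply/eqP; rewrite eqn_leq um ?vm //.
- by rewrite -en.
- by rewrite -e.
- by rewrite en.
- by rewrite e.
Qed.

Section Existence.
Variables a b : nat.
Hypothesis ab : 0 < a < b.

Let good (T : seq nat) : pred nat :=
  fun n => `[< last 0 T < n /\ uniquely_represented T n >].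

Let next (T : seq nat) : nat :=
  if pselect (exists n, good T n) is left h then ex_minn h else 0.

Let hist := fix hist m :=
  if m is m'.+1 then rcons (hist m') (next (hist m')) else [:: a; b].

Let u m := nth 0 (hist m) m.

Let size_hist m : size (hist m) = m.+2.
Proof. by elim: m => //= m IH; rewrite size_rcons IH. Qed.

Let nth_hist m k i : i < m.+2 -> nth 0 (hist (k + m)) i = nth 0 (hist m) i.
Proof.
move=> im; elim: k => //= k IH.
by rewrite nth_rcons size_hist ifT ?IH //; lia.
Qed.

Let histE m : hist m = mkseq u m.+2.
Proof.
apply: (@eq_from_nth _ 0); rewrite size_hist ?size_mkseq // => i im.
rewrite nth_mkseq // /u.
case: (ltnP m i) => mi; last by rewrite -(@nth_hist i (m - i)) ?subnK.
by rewrite -(@nth_hist m (i - m)) ?subnK // ltnW.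
Qed.

Let uSS m : u m.+2 = next (mkseq u m.+2).
Proof.
have := congr1 (nth 0 ^~ m.+2) (histE m.+1).
by rewrite nth_mkseq // => <-; rewrite /= nth_rcons size_hist ltnn eqxx histE.
Qed.

Let last_u m : last 0 (mkseq u m.+2) = u m.+1.
Proof. by rewrite (last_nth 0) size_mkseq /= -[RHS](nth_mkseq 0 u (ltnSn m.+1)). Qed.

Let good_ex m : (forall i j, i < j -> j <= m.+1 -> u i < u j) ->
  exists n, good (mkseq u m.+2) n.
Proof.
move=> inc; have um := inc m m.+1 (ltnSn _) (leqnn _).
have le i j : i <= j -> j <= m.+1 -> u i <= u j.
  by rewrite leq_eqVlt => /orP[/eqP->//|ij jm]; exact/ltnW/inc.
have u0 : 0 < u m.
  have : u 0 <= u m by apply: le.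
  by have -> : u 0 = a by []; lia.
have uin i : i <= m.+1 -> u i \in mkseq u m.+2.
  by move=> im; apply: map_f; rewrite mem_iota; lia.
exists (2 * u m.+1 + u m); apply/asboolP; rewrite last_u; split; first by lia.
exists (u m.+1, u m); split.
  by split => //=; [exact: uin|apply: uin|lia].
case=> x y [/= /mapP[i + ->] /mapP[j + ->]].
rewrite !mem_iota => im jm /eqP ne e.
have ij : i <> j by move=> ij; apply: ne; rewrite ij.
case: (leqP i m) => im'.
  have := le i m im' (leqnSn _); have := le j m.+1 ltac:(lia) (leqnn _); lia.
have ei : i = m.+1 by lia.
by rewrite ei in e *; congr pair; lia.
Qed.

Let next_spec T : (exists n, good T n) ->
  good T (next T) /\ forall n, good T n -> next T <= n.
Proof. by rewrite /next; case: pselect => // h _; case: ex_minnP. Qed.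

Let u_inc m i j : i < j -> j <= m.+1 -> u i < u j.
Proof.
elim: m i j => [|m IH] i j ij jm.
  have [-> ->] : i = 0 /\ j = 1 by lia.
  by rewrite /u /= ; case/andP: ab.
case: (leqP j m.+1) => jm'; first exact: IH.
have -> : j = m.+2 by lia.
have [/asboolP[+ _] _] := next_spec (good_ex IH).
rewrite -uSS last_u => lt; apply: leq_ltn_trans lt.
case: (ltngtP i m.+1) => [im||->//]; last by lia.
exact/ltnW/IH.
Qed.

Lemma is_Z21_exists : exists v, is_Z21 a b v.
Proof.
exists u; split=> // -[//|m] _.
have [/asboolP[]] := next_spec (good_ex (@u_inc m)).
rewrite -uSS last_u => lt ur um; split=> // n ln nr.
by apply: um; apply/asboolP; rewrite last_u.
Qed.

End Existence.

Lemma Z21P a b : 0 < a < b -> is_Z21 a b (Z21 a b).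
Proof. by move=> /is_Z21_exists[u uP]; exact: (@xgetI _ _ _ u). Qed.

(* Main.v *)
(* For m >= 4 the terms up to u m are 3, 15 and the numbers 4k+1 <= 4m-3
   other than 9.  All terms are odd, so 2x+y is odd and 2x+y = y+2 mod 4.
   If m >= 5, then 4m-1 = 2*1+(4m-3) = 2*3+(4m-7) is represented twice.  In a
   representation of 4m+1 the term y is 3 or 15, so x is 2m-1 or 2m-7; exactly
   one of these is 1 mod 4 and it yields the only representation, except that
   for m = 5 and m = 8 it is the missing number 9, and then the other one is 3
   or 15; for m = 11 the other one is 15 as well, but then x = y. *)
Require Import Defs.
From mathcomp Require Import all_boot zify.
From mathcomp Require Import classical_sets.

Local Open Scope classical_set_scope.

(** Comparing first components suffices, since [y] is [n - 2 * x]. *)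
Lemma uniquely_represented_intro (T : seq nat) n x y :
  x \in T -> y \in T -> x != y -> 2 * x + y = n ->
  (forall x' y', x' \in T -> y' \in T -> x' != y' -> 2 * x' + y' = n ->
    x' = x) ->
  uniquely_represented T n.
Proof.
move=> xT yT xy e h; exists (x, y); split=> // -[x' y'] [/= x'T y'T ne e'].
by have ex := h _ _ x'T y'T ne e'; congr pair; lia.
Qed.

Lemma not_uniquely_represented (T : seq nat) n x y x' y' :
  x \in T -> y \in T -> x != y -> 2 * x + y = n ->
  x' \in T -> y' \in T -> x' != y' -> 2 * x' + y' = n ->
  x != x' -> ~ uniquely_represented T n.
Proof.
move=> xT yT xy e x'T y'T x'y' e' /eqP ne [p [_ pP]]; apply: ne.
have [<-] : (x, y) = (x', y') by rewrite -(pP (x, y)) // -(pP (x', y')).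
by [].
Qed.

Lemma uniquely_represented_odd (T : seq nat) n :
  all odd T -> uniquely_represented T n -> odd n.
Proof.
move=> /allP To [[x y] [[/= _ yT _ <-] _]].
by rewrite oddD oddM /= To.
Qed.

(** Inserting 3 and 15 and dropping 9 moves each later number 4k+1 one index up, from k to k+1;
    hence [4 * m - 3]. *)
Definition z13 (m : nat) : nat :=
  if m < 5 then nth 0 [:: 1; 3; 5; 13; 15] m else 4 * m - 3.

Lemma z13_odd m : odd (z13 m).
Proof. by rewrite /z13; case: ltnP => [|?]; [case: m => [|[|[|[|[|]]]]]|lia]. Qed.

Lemma z13_large m : 4 < m -> z13 m = 4 * m - 3.
Proof. by move=> m5; rewrite /z13 ltnNge m5. Qed.

(** Turns membership in a prefix into arithmetic for [lia]. At m = 4 the bound is 13, below the last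
    term 15, which is listed separately. *)
Lemma mem_z13 m x : 4 <= m ->
  (x \in mkseq z13 m.+1) =
  [|| x == 3, x == 15 | [&& x %% 4 == 1, x != 9 & x <= 4 * m - 3]].
Proof.
elim: m => // m IH; rewrite leq_eqVlt => /orP[/eqP <-|m4].
  by rewrite /mkseq /z13 /= !inE; lia.
by rewrite mkseqS mem_rcons inE IH // z13_large //; lia.
Qed.

Lemma z13_step m : 4 <= m -> uniquely_represented (mkseq z13 m.+1) (4 * m + 1).
Proof.
move=> m4.
have [x [y [xT yT xy e]]] : exists x y, [/\ x \in mkseq z13 m.+1,
    y \in mkseq z13 m.+1, x != y & 2 * x + y = 4 * m + 1].
  have [small|big] : (m = 8 \/ odd m /\ m <> 5) \/ (m = 5 \/ ~~ odd m /\ m <> 8)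
    by lia.
  - by exists (2 * m - 1), 3; rewrite !mem_z13 //; split; lia.
  - by exists (2 * m - 7), 15; rewrite !mem_z13 //; split; lia.
apply: (uniquely_represented_intro _ _ x y) => // x' y'.
by move: xT yT xy; rewrite !mem_z13 //; lia.
Qed.

Lemma z13P : is_Z21 1 3 z13.
Proof.
split=> // m m1.
have Todd : all odd (mkseq z13 m.+1).
  by apply/allP => _ /mapP[i _ ->]; exact: z13_odd.
have [m4|m4] := leqP 4 m.
  have -> : z13 m.+1 = 4 * m + 1 by rewrite z13_large //; lia.
  have zm : m = 4 /\ z13 m = 15 \/ 4 < m /\ z13 m = 4 * m - 3.
    by move: m4; rewrite leq_eqVlt => /orP[/eqP <-|m5];
      [left|right; rewrite z13_large].
  split; [lia|exact: z13_step|].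
  move=> n zn nr; rewrite leqNgt; apply/negP => n1.
  have no := uniquely_represented_odd _ _ Todd nr.
  (* For m = 4 no odd number lies strictly between 15 and 17. *)
  have [m5 en] : 4 < m /\ n = 4 * m - 1 by lia.
  (* As 4 < m, the number 4m-7 is at least 13, so it is not the missing 9. *)
  apply: (not_uniquely_represented _ n 1 (4 * m - 3) 3 (4 * m - 7) _ _ _ _ _ _ _ _ _ nr);
    rewrite ?mem_z13 //; lia.
have [e|[e|e]] : m = 1 \/ m = 2 \/ m = 3 by lia.
all: have odd_repr n := uniquely_represented_odd _ n Todd.
all: move: odd_repr; rewrite e /mkseq /z13 /= => odd_repr {Todd}.
- split=> [//||n n3 /odd_repr]; last by lia.
  apply: (uniquely_represented_intro _ _ 1 3) => // x y.
  rewrite !inE /=; lia.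
- split=> [//||n n5 nr].
    apply: (uniquely_represented_intro _ _ 5 3) => // x y.
    rewrite !inE /=; lia.
  rewrite leqNgt; apply/negP => n13.
  have no := odd_repr _ nr.
  have [en|[en|en]] : n = 7 \/ n = 9 \/ n = 11 by lia.
  + by apply: (not_uniquely_represented _ n 3 1 1 5 _ _ _ _ _ _ _ _ _ nr).
  (* 9 is skipped because its only candidate, 2*3+3, repeats a term. *)
  + have [[x y] [[/= + + + +] _]] := nr.
    rewrite !inE /=; lia.
  + by apply: (not_uniquely_represented _ n 5 1 3 5 _ _ _ _ _ _ _ _ _ nr).
- split=> [//||n n13 /odd_repr].
    apply: (uniquely_represented_intro _ _ 1 13) => // x y.
    rewrite !inE /=; lia.
  lia.
Qed.

Theorem theorem1p5 :
  range (Z21 1 3) =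
    [set 3; 15] `|` (range (fun k : nat => 4 * k + 1) `\ 9).
Proof.
rewrite (is_Z21_inj (Z21P (a := 1) (b := 3) isT) z13P).
apply/seteqP; split=> [_ [m _ <-]|x].
  (* Adding 4 makes the prefix long enough for [mem_z13]. *)
  have : z13 m \in mkseq z13 (m + 4).+1.
    by apply: map_f; rewrite mem_iota; lia.
  rewrite mem_z13; last by lia.
  case/or3P => [/eqP->|/eqP->|/and3P[/eqP z1 /eqP z9 _]];
    [by left; left|by left; right|right].
  by split=> //; exists (z13 m %/ 4) => //; lia.
(* Here the upper bound in [mem_z13] is 4(x+4)-3, which exceeds x. *)
move=> xP; have : x \in mkseq z13 (x + 4).+1.
  rewrite mem_z13; last by lia.
  by case: xP => [[->|->]|[[k _ <-] /= k9]] //; lia.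
by case/mapP => m _ ->; exists m.
Qed.
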